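(* Let $F$ be an oriented tree of order $n$ and $k$ a positive integer. Every tournament on at least $2^{10+18k}\,k\,n$ vertices contains $F[k]$.
   Context: An oriented tree is an orientation of a tree. The $k$-blow-up $D[k]$ of a digraph $D$ has vertex set $\{(v,i): v\in V(D), i\in[k]\}$ and arc set $\{(u,i)(v,j): uv\in A(D), i,j\in[k]\}$, i.e. each vertex $u$ is replaced by an independent set $X_u$ of size $k$ and each arc $uv$ by all arcs from $X_u$ to $X_v$. A tournament contains a digraph if it has a subdigraph isomorphic to it. *)

(* Defs.v *)
(* Graphs and digraphs on a finite type are boolean relations. *)
From mathcomp Require Import all_boot.

Set Implicit Arguments.
Unset Strict Implicit.
Unset Printing Implicit Defensive.

Definition simple_graph (V : finType) (g : rel V) : Prop :=
  symmetric g /\ irreflexive g.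

(* A tree is a nonempty connected graph without cycles.  The bound on the size
   of [c] is needed because [ucycle g [:: x; y]] holds for every edge xy. *)
Definition tree (V : finType) (g : rel V) : Prop :=
  [/\ simple_graph g, 0 < #|V|, (forall x y : V, connect g x y)
    & forall c : seq V, 2 < size c -> ~ ucycle g c].

Definition orientation_of (V : finType) (g d : rel V) : Prop :=
  forall x y : V, (g x y -> d x y (+) d y x) /\ (d x y -> g x y).

Definition oriented_tree (V : finType) (d : rel V) : Prop :=
  exists2 g : rel V, tree g & orientation_of g d.

(* A tournament is an orientation of the complete graph. *)
Definition tournament (V : finType) (d : rel V) : Prop :=
  orientation_of (fun x y : V => x != y) d.

Definition blow_up (V : finType) (d : rel V) (k : nat) : rel (V * 'I_k) :=
  fun p q => d p.1 q.1.
Arguments blow_up {V} d k.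

Definition isomorphic (V W : finType) (d : rel V) (e : rel W) : Prop :=
  exists2 f : V -> W, bijective f & forall x y : V, e (f x) (f y) = d x y.

(* A subdigraph is a vertex subset [S] with a set [a] of arcs of the ambient
   digraph between vertices of [S]; it need not be induced. *)
Definition contains (U V : finType) (t : rel U) (d : rel V) : Prop :=
  exists (S : {set U}) (a : rel {x : U | x \in S}),
    (forall x y, a x y -> t (val x) (val y)) /\ isomorphic d a.

(* Main.v *)
(* Number the vertices of the tree so that every vertex other than the root has
   exactly one smaller neighbour, its parent, and cut the tree at the arcs that
   go from a parent to a child.  The resulting pieces are trees all of whose
   arcs point towards the root of the piece.

   In a median order every vertex dominates at least half of each interval that
   starts just after it.  Hence, if S lies in a block of length l and W is an
   interval of length at least 2l that follows the block, every vertex of S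
   dominates at least a quarter of W.  A Kovari-Sos-Turan argument then finds in
   S a k-set with a common out-neighbourhood of proportion 32^-k in W, where the
   next pieces can be placed.  The frontiers that bound the intervals W are
   fixed in advance from the sizes of the pieces, so that vertices already used
   fill at most half of what is available.

   The argument is applied twice: to the tree of pieces in the tournament, and,
   to embed one piece inside the available set S, to the vertices of that piece
   in a median order of the reversed tournament on S.  In the second use a
   k-set is chosen with large common neighbourhoods on both sides at once, by
   counting pairs of vertices. *)
Require Import Defs.
From mathcomp Require Import all_boot.
From mathcomp Require Import zify.

Set Implicit Arguments.
Unset Strict Implicit.
Unset Printing Implicit Defensive.

(** * Counting common neighbours *)

Lemma leq_ffact_exp (d k : nat) : (d - k.-1) ^ k <= d ^_ k.
Proof.
elim: k d => [|k IH] d; first by [].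
rewrite ffactnS expnS /=.
have [le_dk|lt_kd] := leqP d k; first by rewrite (eqnP le_dk).
apply: leq_mul; first by rewrite leq_subr.
case: k IH lt_kd => [|k] IH lt_kd //.
by apply: leq_trans (IH d.-1); rewrite leq_exp2r //=; lia.
Qed.

(** Convexity: the tangent to $y^{k+1}$ at $t$ lies below the curve, written without subtraction. *)
Lemma bernoulli_tangent (k t y : nat) :
  k.+1 * t ^ k * y <= y ^ k.+1 + k * t ^ k.+1.
Proof.
elim: k => [|k IH]; first by rewrite expn0 expn1 mul0n addn0 !mul1n.
have sq : 2 * (y * t) <= y ^ 2 + t ^ 2.
  have /leqifP := nat_Cauchy y t.
  by case: ifP => _; [move/eqP-> | move/ltnW].
have {}IH := leq_mul (leqnn y) IH.
have {sq} := leq_mul (leqnn (k.+1 * t ^ k)) sq.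
by move: IH; rewrite !expnS; move: (t ^ k) (y ^ k) => a b; nia.
Qed.

(** Power mean inequality, by summing the tangents at the lower bound [t] of the average. *)
Lemma sum_expn_ge (I : finType) (A : {set I}) (y : I -> nat) (k t : nat) :
  0 < k -> t * #|A| <= \sum_(i in A) y i ->
  t ^ k * #|A| <= \sum_(i in A) y i ^ k.
Proof.
case: k => // k _ le_t.
have: \sum_(i in A) (k.+1 * t ^ k * y i)
    <= \sum_(i in A) (y i ^ k.+1 + k * t ^ k.+1).
  by apply: leq_sum => i _; apply: bernoulli_tangent.
rewrite -big_distrr big_split /= sum_nat_const.
have := leq_mul (leqnn (k.+1 * t ^ k)) le_t.
rewrite expnS; move: (\sum_(i in A) y i) (\sum_(i in A) _ ^ _) #|A| (t ^ k).
move=> a b c d; nia.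
Qed.

Section KST.
Variables (I J : finType) (r : I -> J -> bool).

Lemma sum_degE (S : {set I}) (Q : {set J}) :
  \sum_(j in Q) #|[set i in S | r i j]| = \sum_(i in S) #|[set j in Q | r i j]|.
Proof.
transitivity (\sum_(j in Q) \sum_(i in S) (r i j : nat)).
  apply: eq_bigr => j _; rewrite -sum1dep_card big_mkcondr.
  by apply: eq_bigr => i _; case: (r i j).
rewrite exchange_big; apply: eq_bigr => i _.
rewrite -sum1dep_card [RHS]big_mkcondr.
by apply: eq_bigr => j _; case: (r i j).
Qed.

(* Averaging over the choice of one element at a time. *)
Lemma common_ffact (k : nat) (S : {set I}) (Q : {set J}) : k <= #|S| ->
  exists X : {set I}, [/\ X \subset S, #|X| = k
    & \sum_(j in Q) #|[set i in S | r i j]| ^_ k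
      <= #|S| ^ k * #|[set j in Q | [forall i in X, r i j]]|].
Proof.
elim: k S Q => [|k IH] S Q ltkS.
  exists set0; split; [exact: sub0set | exact: cards0 |].
  rewrite expn0 mul1n (eq_bigr (fun=> 1)) => [|i _]; last by rewrite ffactn0.
  rewrite sum1_card; apply: subset_leq_card; apply/subsetP => j jQ.
  by rewrite inE jQ; apply/forall_inP => i; rewrite inE.
have S0 : 0 < #|S| by apply: leq_trans ltkS.
pose D x j := #|[set i in S :\ x | r i j]|.
(* In $d^{\underline{k+1}} = d\,(d-1)^{\underline{k}}$ the factor $d$ counts the choices of a first
   element [x] among the neighbours of [j]. *)
have sumE : \sum_(j in Q) #|[set i in S | r i j]| ^_ k.+1
          = \sum_(x in S) \sum_(j in [set j in Q | r x j]) D x j ^_ k.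
  rewrite (exchange_big_dep (fun j => j \in Q)) /=;
    last by move=> x j _; rewrite inE => /andP[].
  apply: eq_bigr => j jQ; rewrite ffactnS.
  rewrite (eq_bigr (fun=> #|[set i in S | r i j]|.-1 ^_ k)).
    by rewrite sum_nat_const; congr (_ * _); apply: eq_card => x;
      rewrite inE [RHS]unfold_in inE jQ.
  move=> x /andP[xS]; rewrite inE => /andP[_ rxj]; congr (_ ^_ _).
  rewrite (cardsD1 x [set i in S | r i j]) inE xS rxj add1n /=; apply: eq_card => i.
  by rewrite !inE andbA.
have [x xS le_x] : exists2 x, x \in S & \sum_(j in Q) #|[set i in S | r i j]| ^_ k.+1
    <= #|S| * \sum_(j in [set j in Q | r x j]) D x j ^_ k.
  have [x0 x0S] := card_gt0P S0.
  pose h x := \sum_(j in [set j in Q | r x j]) D x j ^_ k.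
  case: (@arg_maxnP _ x0 (mem S) h x0S) => x xS mx; exists x => //.
  rewrite sumE -sum_nat_const; exact: leq_sum.
have [|X [sXS cX le_X]] := IH (S :\ x) [set j in Q | r x j].
  by move: ltkS; rewrite (cardsD1 x S) xS.
have xX : x \notin X by apply/negP => /(subsetP sXS); rewrite !inE eqxx.
exists (x |: X); split.
- by rewrite subUset sub1set xS (subset_trans sXS) // subD1set.
- by rewrite cardsU1 xX cX.
apply: (leq_trans le_x); rewrite expnS -mulnA leq_mul2l; apply/orP; right.
apply: (leq_trans le_X); apply: leq_mul.
  by case: (k) => // k1; rewrite leq_exp2r ?subset_leq_card ?subD1set.
apply: subset_leq_card; apply/subsetP => j; rewrite !inE => /andP[/andP[-> rxj]] /forall_inP rX.
by apply/forall_inP => i; rewrite !inE => /orP[/eqP->|/rX].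
Qed.

(** Once [S] is cut down to [32 * k] elements, an element of [Q] has on average at least [2 * k]
    neighbours there, hence still [k] after [k.-1] is subtracted. Convexity gives $k^k|Q|$, and
    dividing by $(32k)^k$ leaves $32^{-k}$. *)
Lemma kovari_sos_turan (k : nat) (S : {set I}) (Q : {set J}) : 0 < k ->
  32 * k <= #|S| -> (forall i, i \in S -> #|Q| <= 16 * #|[set j in Q | r i j]|) ->
  exists X : {set I}, [/\ X \subset S, #|X| = k
    & #|Q| <= 32 ^ k * #|[set j in Q | [forall i in X, r i j]]|].
Proof.
move=> k0 leS degS.
have [S' [sS' cS']] : exists S' : {set I}, S' \subset S /\ #|S'| = 32 * k.
  have [A] := card_geqP leS.
  move=> [uA sA ssub].
  exists [set x in A]; split; first by apply/subsetP => x; rewrite inE => /ssub.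
  by rewrite cardsE; move/card_uniqP: uA => ->.
have [|X [sX cX le_X]] := @common_ffact k S' Q; first by rewrite cS'; lia.
exists X; split=> //; first exact: subset_trans sX sS'.
have dge : 32 * k * #|Q| <= 16 * \sum_(j in Q) #|[set i in S' | r i j]|.
  rewrite sum_degE big_distrr -cS' -sum_nat_const /=.
  by apply: leq_sum => i /(subsetP sS')/degS.
have yge : k * #|Q| <= \sum_(j in Q) (#|[set i in S' | r i j]| - k.-1).
  have : \sum_(j in Q) #|[set i in S' | r i j]| <=
    \sum_(j in Q) ((#|[set i in S' | r i j]| - k.-1) + k.-1).
    by apply: leq_sum => j _; lia.
  rewrite big_split /= sum_nat_const; move: dge; case: (k) k0 => //= k' _.
  by move: (\sum_(j in Q) _) (\sum_(j in Q) _); nia.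
have ge1 := sum_expn_ge k0 yge.
have ge2 : k ^ k * #|Q| <= (32 * k) ^ k * #|[set j in Q | [forall i in X, r i j]]|.
  rewrite -cS'; apply: leq_trans le_X; apply: (leq_trans ge1).
  by apply: leq_sum => j _; apply: leq_ffact_exp.
move: ge2; rewrite expnMn [32 ^ k * _]mulnC -mulnA leq_pmul2l //.
by rewrite expn_gt0 k0.
Qed.
End KST.

(** * Median orders *)

Section MedianOrder.
Variables (U : finType) (T : rel U).
Hypothesis T_semicomplete : forall x y, x != y -> T x y || T y x.

Fixpoint forward_arcs (s : seq U) : nat :=
  if s is x :: s' then count (T x) s' + forward_arcs s' else 0.

Lemma forward_arcs_cat (s t : seq U) :
  forward_arcs (s ++ t)
  = forward_arcs s + forward_arcs t + \sum_(x <- s) count (T x) t.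
Proof.
elim: s => [|x s IH] /=; first by rewrite big_nil addn0.
by rewrite IH count_cat big_cons; lia.
Qed.

Lemma forward_arcs_move (a b c : seq U) (x : U) :
  forward_arcs (a ++ b ++ x :: c) + count (T x) b
  = forward_arcs (a ++ x :: b ++ c) + count (T^~ x) b.
Proof.
have sumE : \sum_(y <- b) count (T y) (x :: c)
    = count (T^~ x) b + \sum_(y <- b) count (T y) c.
  rewrite /= big_split /=; congr (_ + _).
  by elim: b => [|y b IH]; rewrite ?big_nil // big_cons IH.
have permE : \sum_(y <- a) count (T y) (b ++ x :: c)
    = \sum_(y <- a) count (T y) (x :: b ++ c).
  by apply: eq_bigr => y _; rewrite /= !count_cat /=; lia.
by rewrite !forward_arcs_cat permE sumE /= forward_arcs_cat count_cat; lia.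
Qed.

(** In place of the global maximality of [forward_arcs], only its local consequence is recorded. *)
Definition median_order (s : seq U) : Prop :=
  forall (a b c : seq U) (x : U), s = a ++ x :: b ++ c ->
    size b <= 2 * count (T x) b.

(** In a permutation that maximises [forward_arcs], moving [x] behind [b] gains nothing, so [x] has
    at least as many out-neighbours as in-neighbours in [b]. *)
Lemma median_order_exists (Z : {set U}) :
  exists s : seq U, [/\ uniq s, s =i Z & median_order s].
Proof.
pose L := permutations (enum Z).
pose P m := has (fun s => forward_arcs s == m) L.
have exP : exists m, P m.
  exists (forward_arcs (enum Z)); apply/hasP; exists (enum Z) => //.
  by rewrite mem_permutations.
have ubP m : P m -> m <= \sum_(s <- L) forward_arcs s.
  by case/hasP => s sL /eqP <-; rewrite (big_rem s sL) leq_addr.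
case: (ex_maxnP exP ubP) => m /hasP[s sL /eqP sm] max_m.
move: (sL); rewrite mem_permutations => permZ.
have us : uniq s by rewrite (perm_uniq permZ) enum_uniq.
exists s; split=> //; first by move=> x; rewrite (perm_mem permZ) mem_enum.
move=> a b c x sE.
have le_fwd : forward_arcs (a ++ b ++ x :: c) <= forward_arcs (a ++ x :: b ++ c).
  rewrite -sE sm; apply: max_m; apply/hasP; exists (a ++ b ++ x :: c) => //.
  rewrite mem_permutations -(permPr permZ) sE perm_cat2l.
  by rewrite -cat1s perm_catCA.
have xb : x \notin b.
  by move: us; rewrite sE cat_uniq /= mem_cat !negb_or => /and3P[_ _ /andP[/andP[]]].
have : size b <= count (T x) b + count (T^~ x) b.
  elim: b xb {sE le_fwd} => //= y b IH; rewrite inE negb_or => /andP[xy /IH].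
  by have := T_semicomplete xy; case: (T x y); case: (T y x) => //= _; lia.
by have := forward_arcs_move a b c x; lia.
Qed.
End MedianOrder.

(** * Segments of a median order *)

Section Segments.
Variables (U : finType) (s : seq U).
Hypothesis uniq_s : uniq s.

Definition segment (a b : nat) : {set U} := [set x in s | a <= index x s < b].

Lemma segmentS (a b a' b' : nat) : a' <= a -> b <= b' ->
  segment a b \subset segment a' b'.
Proof.
move=> la lb; apply/subsetP => x; rewrite !inE => /and3P[-> h1 h2] /=.
by rewrite (leq_trans la) // (leq_trans h2).
Qed.

Lemma segment0E (b : nat) : segment 0 b = [set x in take b s].
Proof.
apply/setP => x; rewrite !inE /=; case xs: (x \in s); first by rewrite in_take.
by apply/esym/negbTE/negP => /mem_take; rewrite xs.
Qed.

Lemma card_segment0 (b : nat) : b <= size s -> #|segment 0 b| = b.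
Proof.
move=> lb; rewrite segment0E cardsE.
by have /card_uniqP -> := take_uniq b uniq_s; rewrite size_takel.
Qed.

Lemma card_segment (a b : nat) : b <= size s -> #|segment a b| = b - a.
Proof.
move=> lb; have [lab|lba] := leqP a b; last first.
  apply/eqP; rewrite (_ : b - a = 0) ?cards_eq0; last by lia.
  by apply/eqP/setP => x; rewrite !inE; apply/negbTE; lia.
have -> : segment a b = segment 0 b :\: segment 0 a.
  by apply/setP => x; rewrite !inE; case: (x \in s) => //=; lia.
rewrite cardsD (setIidPr (segmentS _ _)) // !card_segment0 //.
exact: leq_trans lb.
Qed.

(** The median property covers everything from [x] to [M]; the out-neighbours it provides may fill
    the gap before [b], which costs the last summand. If the gap is at most half of [M - b], a
    quarter of the segment remains. *)
Lemma segment_outdegree (T : rel U) (x : U) (b M : nat) :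
  median_order T s -> x \in s -> index x s < b -> b <= M -> M <= size s ->
  M - b <= 2 * #|[set y in segment b M | T x y]| + (b - (index x s).+1).
Proof.
move=> med xs; set q := index x s => lqb lbM lMs.
pose m := take (M - q.+1) (drop q.+1 s).
have sE : s = take q s ++ x :: m ++ drop M s.
  rewrite -{1}(cat_take_drop q s) (drop_nth x) ?index_mem //.
  rewrite nth_index // -{1}(cat_take_drop (M - q.+1) (drop q.+1 s)) drop_drop.
  by rewrite subnK //; apply: leq_trans lbM.
have size_m : size m = M - q.+1 by rewrite size_takel // size_drop; lia.
have um : uniq m by rewrite take_uniq // drop_uniq.
have := med _ _ _ _ sE; rewrite size_m.
have cm : count (T x) m = #|[set y in m | T x y]|.
  rewrite -size_filter cardsE; apply/esym.
  have /card_uniqP <- := filter_uniq (T x) um.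
  by apply: eq_card => y; rewrite mem_filter [LHS]unfold_in andbC.
have sub : [set y in m | T x y] \subset
    segment q.+1 b :|: [set y in segment b M | T x y].
  apply/subsetP => y; rewrite !inE => /andP[ym Txy].
  have ys : y \in s by rewrite (mem_drop (mem_take ym)).
  have ly : index y s < M.
    rewrite -in_take //; move: ym; rewrite /m take_drop subnK; first exact: mem_drop.
    exact: leq_trans lbM.
  have gy : q < index y s.
    rewrite ltnNge -ltnS -(in_take _ ys); apply/negP => yt.
    have := uniq_s; rewrite -(cat_take_drop q.+1 s) cat_uniq => /and3P[_ /hasPn h _].
    by have := h _ (mem_take ym); rewrite yt.
  by rewrite ys Txy ly gy /=; case: ltnP.
have := subset_leq_card sub.
have := leq_card_setU (segment q.+1 b) [set y in segment b M | T x y].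
move/leq_of_leqif.
by rewrite card_segment ?(leq_trans lbM) // cm; lia.
Qed.
End Segments.

(** * Embedding a tree of parts *)

(** Pigeonhole over consecutive blocks of length $4Da$: [N] has density at least $1/(2D)$, and the
    incomplete last block costs another factor 2. *)
Lemma dense_block (U : finType) (s : seq U) (N : {set U}) (b0 M a D : nat) :
  N \subset segment s b0 M -> 0 < a -> 0 < D -> 4 * D * a <= M - b0 ->
  M - b0 <= 2 * D * #|N| ->
  exists2 b, b <= M & a <= #|N :&: segment s (b - 4 * D * a) b|.
Proof.
move=> sN a0 D0; set l := 4 * D * a => le_l le_d.
have l0 : 0 < l by rewrite !muln_gt0 D0 a0.
pose t := ((M - b0) %/ l).+1.
pose h x := (index x s - b0) %/ l.
have ht x : x \in N -> h x < t.
  move/(subsetP sN); rewrite !inE => /and3P[_ h1 h2].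
  by rewrite ltnS leq_div2r //; lia.
have NE : #|N| = \sum_(j < t) #|[set x in N | h x == j]|.
  rewrite -sum1_card (partition_big (fun x => inord (h x) : 'I_t) predT) //=.
  apply: eq_bigr => j _; rewrite -sum1dep_card; apply: eq_bigl => x.
  by case xN: (x \in N) => //=; rewrite -val_eqE /= inordK ?ht.
have [/existsP[j le_a] | /existsPn small] :=
  boolP [exists j : 'I_t, a <= #|[set x in N | h x == j]|].
  (* The last block may overrun [M]; ending it at [M] shifts its start to the left, which loses
     nothing of [N]. *)
  exists (minn (b0 + j.+1 * l) M); first exact: geq_minr.
  apply: (leq_trans le_a); apply: subset_leq_card; apply/subsetP => x.
  rewrite !inE => /andP[xN /eqP hx]; rewrite xN /=.
  have := subsetP sN _ xN; rewrite !inE => /and3P[-> h1 h2] /=.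
  have := divn_eq (index x s - b0) l; rewrite -/(h x) hx.
  have := ltn_mod (index x s - b0) l; rewrite l0.
  by rewrite mulSn; move: (_ %% l) (j * l); lia.
have : #|N| <= t * a.-1.
  rewrite NE -[t in t * _]card_ord -sum_nat_const; apply: leq_sum => j _.
  by have := small j; lia.
have : t * l <= 2 * (M - b0).
  by have := leq_divM (M - b0) l; rewrite /t mulSn; lia.
move: le_d; rewrite /l (_ : t = t.-1.+1) //.
by move: #|N| t.-1 (M - b0) => c u d; nia.
Qed.

Section Embedding.
Variables (U : finType) (T : rel U).
Hypothesis T_semicomplete : forall x y, x != y -> T x y || T y x.

Definition complete_to (X Y : {set U}) : Prop :=
  forall x y, x \in X -> y \in Y -> T x y.

Definition common_out (W X : {set U}) : {set U} :=
  [set y in W | [forall x in X, T x y]].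

(* The vertices to embed are the [v <= n] with [0 < part v]; the value [0] marks
   the vertices outside the domain, and also serves as a virtual part that is
   the parent of the root parts.  Part [c] is placed in the common
   out-neighbourhood of the image of the vertex [attach c]. *)
Variables (k A D n : nat) (part attach : nat -> nat) (E : rel nat).
Variables (R : {set U} -> Prop) (Z : {set U}).
Hypotheses (k_gt0 : 0 < k) (D_gt0 : 0 < D) (le_kA : k <= 2 * A).
Hypothesis part_le : forall v, part v <= v.
Hypothesis part_out : forall v, n < v -> part v = 0.
Hypothesis attach_lt : forall c, 0 < c -> part (attach c) < c.

Definition weight (c : nat) := \sum_(v < n.+1) ((0 < c) && (part v == c)).

(** This keeps the inside of a part abstract. For one-vertex parts a single choice of a [k]-set
    suffices; for pieces the embedding result of this section is used again. *)
Hypothesis place_part : forall (c : nat) (S W : {set U}),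
  0 < c -> 0 < weight c -> S \subset Z -> A * weight c <= #|S| -> 0 < #|W| ->
  (forall x, x \in S -> #|W| <= 4 * #|[set y in W | T x y]|) ->
  exists g : nat -> {set U},
   [/\ forall v, part v = c ->
         [/\ g v \subset S, #|g v| = k, R (g v)
           & #|W| <= D * #|common_out W (g v)|],
       forall u v, part u = c -> part v = c -> u != v -> [disjoint g u & g v]
     & forall u v, part u = c -> part v = c -> E u v ->
         complete_to (g u) (g v)].

Definition parent c := part (attach c).
Definition offspring i :=
  \sum_(v < n.+1) ((0 < part v) && (parent (part v) == i)).
Definition slack := 8 * D * A.
(** The increment at [i.+1] makes room for three things: [weight i.+1] for an interval at least
    twice as long as the block that holds the part, [offspring i.+1] for the children to come, and
    [offspring i] to pay for vertices already used. *)
Definition frontier i :=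
  slack * (\sum_(j < i.+1) (weight j + offspring j) + \sum_(j < i) offspring j).
Definition covered := \sum_(v < n.+1) (0 < part v).

Lemma frontierS i :
  frontier i.+1
  = frontier i + slack * (weight i.+1 + offspring i.+1 + offspring i).
Proof.
rewrite /frontier -mulnDr; congr (slack * _); rewrite big_ord_recr /=.
by rewrite [\sum_(j < i.+1) offspring j]big_ord_recr /= addnAC !addnA addnAC -!addnA; lia.
Qed.

Lemma frontier_mono i j : i <= j -> frontier i <= frontier j.
Proof.
move=> lij; rewrite -(subnK lij); elim: (j - i) => // d IH.
by rewrite addSn frontierS (leq_trans IH) // leq_addr.
Qed.

Lemma frontier_parent c : 0 < c ->
  frontier (parent c) + slack * (weight c + offspring c) <= frontier c.
Proof.
case: c => // c _.
have := frontier_mono (attach_lt (isT : 0 < c.+1) : parent c.+1 <= c).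
by rewrite frontierS !mulnDr; lia.
Qed.

Lemma weight_offspring c : 0 < c -> weight c <= offspring (parent c).
Proof.
move=> c0; apply: leq_sum => v _; rewrite c0 /=.
by case: eqP => // ->; rewrite c0 eqxx.
Qed.

(** The 24 is three times the 8 in [slack]: each of the three sums counts a vertex at most once. *)
Lemma frontier_last : frontier n <= 24 * D * A * covered.
Proof.
have sum1 (P : pred 'I_n.+1) (h : 'I_n.+1 -> nat) m :
    \sum_(j < m) \sum_(v < n.+1) (P v && (h v == j)) <= \sum_(v < n.+1) P v.
  rewrite exchange_big /=; apply: leq_sum => v _; case: (P v) => /=; last by rewrite big1.
  elim: m => [|m IH]; first by rewrite big_ord0.
  rewrite big_ord_recr /=; case: eqP => [hm|_]; last by rewrite addn0.
  rewrite big1 // => j _; rewrite hm; case: eqP => // mj.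
  by have := ltn_ord j; rewrite -mj ltnn.
have s1 : \sum_(j < n) offspring j <= covered.
  exact: (sum1 (fun v : 'I__ => 0 < part v) (fun v : 'I__ => parent (part v))).
have s2 : \sum_(j < n.+1) offspring j <= covered.
  exact: (sum1 (fun v : 'I__ => 0 < part v) (fun v : 'I__ => parent (part v))).
have s3 := sum1 (fun v : 'I__ => 0 < part v) (fun v : 'I__ => part v) n.+1.
have s4 : \sum_(j < n.+1) weight j <= covered.
  apply: leq_trans s3; apply: leq_sum => j _; apply: leq_sum => v _.
  by case: eqP => [->|_]; rewrite ?andbF.
have -> : 24 * D * A * covered = slack * (3 * covered) by rewrite /slack; lia.
rewrite leq_mul2l big_split /=; apply/orP; right.
by rewrite (_ : 3 * covered = covered + covered + covered) ?leq_add //; lia.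
Qed.

(* Bounds the number of used vertices at positions [>= b0]: each lies in a part
   whose parent has its frontier beyond [b0]. *)
Lemma used_bound i b0 : b0 + slack * offspring i <= frontier i ->
  slack * \sum_(j < i.+1 | b0 < frontier j) offspring j <= 2 * (frontier i - b0).
Proof.
move=> le_b0.
(* The summand [offspring m] in the increment from [m] to [m.+1] pays for the terms below [i]; the
   term [i] is paid by the hypothesis, hence the factor 2. *)
have aux m :
    slack * \sum_(j < m | b0 < frontier j) offspring j <= frontier m - b0.
  elim: m => [|m IH]; first by rewrite big_ord0 muln0.
  rewrite big_mkcond big_ord_recr -big_mkcond /= mulnDr.
  move: IH; move: (\sum_(j < m | _) _) => x IH.
  case: ltnP => [lt_b|le_b]; first by rewrite frontierS !mulnDr; lia.
  by rewrite muln0 addn0 (leq_trans IH) // leq_sub2r // frontier_mono.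
rewrite big_mkcond big_ord_recr -big_mkcond /= mulnDr.
have := aux i; move: (\sum_(j < i | _) _) => x.
by case: ifP => _; lia.
Qed.


(* The children of part [0] are placed first, then those of part [1], etc. *)
Definition key (c : nat) := parent c * n.+1 + c.
Definition placed (K v : nat) := (0 < part v) && (key (part v) < K).

(** * Placing the parts one by one *)

Section PartialEmbedding.
Variable s : seq U.
Hypotheses (uniq_s : uniq s) (sZ : s =i Z) (s_median : median_order T s).
Hypothesis Z_large : 24 * D * A * covered <= #|Z|.

(* [W_c = segment s (b c) (frontier c)] is where the children of the placed part
   [c] will go; [frontier] is independent of the choices made so far. *)
Definition partial_embedding (K : nat) (f : nat -> {set U}) (b : nat -> nat) :=
  [/\ forall v, placed K v ->
        [/\ f v \subset segment s 0 (frontier (parent (part v))),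
            #|f v| = k, R (f v),
            b (part v) + slack * offspring (part v) <= frontier (part v)
          & frontier (part v) - b (part v) <=
            D * #|common_out (segment s (b (part v)) (frontier (part v))) (f v)|],
      forall u v, placed K u -> placed K v -> u != v -> [disjoint f u & f v],
      forall u v, placed K u -> part u = part v -> E u v ->
        complete_to (f u) (f v)
    & forall v, placed K v -> 0 < parent (part v) ->
        complete_to (f (attach (part v))) (f v)].

Lemma part_le_n v : part v <= n.
Proof. by have [/part_out->|] := ltnP n v; [|apply: leq_trans]. Qed.

Lemma frontier_size i : i <= n -> frontier i <= size s.
Proof.
move=> le_in; have <- : #|Z| = size s by rewrite -(card_uniqP uniq_s); apply: eq_card.
exact: leq_trans (frontier_mono le_in) (leq_trans frontier_last Z_large).
Qed.

Lemma placed_lt K v : placed K v -> v < n.+1.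
Proof.
by case/andP => pv _; rewrite ltnS leqNgt; apply/negP => /part_out E0; rewrite E0 in pv.
Qed.

Lemma available_region K f b c : partial_embedding K f b ->
  0 < c -> c <= n -> key c = K ->
  exists b0 (N : {set U}), [/\ b0 + slack * offspring (parent c) <= frontier (parent c),
    N \subset segment s b0 (frontier (parent c)),
    frontier (parent c) - b0 <= D * #|N|
  & 0 < parent c -> complete_to (f (attach c)) N].
Proof.
move=> [emb _ _ _] c0 le_cn keyc; have ltc := attach_lt c0; rewrite -/(parent c) in ltc.
case: (posnP (parent c)) => [p0|p_gt0].
  (* A child of the virtual part may use the whole initial segment. *)
  exists 0, (segment s 0 (frontier (parent c))); split.
  - by rewrite p0 /frontier big_ord_recr !big_ord0 /= !mulnDr; lia.
  - by [].
  - by rewrite card_segment ?subn0 ?leq_pmull //; apply: frontier_size; lia.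
  - by rewrite p0.
(* The part of [attach c] has a smaller parent than [c], hence a smaller key. *)
have pl : placed K (attach c).
  rewrite /placed -/(parent c) p_gt0 -keyc /key.
  by have := attach_lt p_gt0; rewrite -/(parent _); nia.
have [_ _ _ h1 h2] := emb _ pl.
exists (b (parent c)).
exists (common_out (segment s (b (parent c)) (frontier (parent c)))
                   (f (attach c))).
split=> //; first by apply/subsetP => x; rewrite inE => /andP[].
by move=> _ x y xf; rewrite inE => /andP[_ /forall_inP]; apply.
Qed.

(** The image of a placed vertex lies below the frontier of its parent part, so it reaches past [b0]
    only if that frontier does; the order of the keys restricts these parents to at most
    [parent c]. *)
Lemma card_used K f b c b0 : partial_embedding K f b ->
  0 < c -> c <= n -> key c = K ->
  #|segment s b0 (size s) :&: \bigcup_(v < n.+1 | placed K v) f v|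
  <= k * \sum_(j < (parent c).+1 | b0 < frontier j) offspring j.
Proof.
move=> [emb _ _ _] c0 le_cn keyc.
pose Q (v : nat) := placed K v && (b0 < frontier (parent (part v))).
have sub : segment s b0 (size s) :&: \bigcup_(v < n.+1 | placed K v) f v
    \subset \bigcup_(v < n.+1 | Q v) f v.
  apply/subsetP => x; rewrite !inE => /andP[/and3P[_ le_b _]] /bigcupP[v pl xv].
  apply/bigcupP; exists v => //; rewrite /Q pl /=.
  have [/subsetP /(_ _ xv) sub _ _ _ _] := emb _ pl.
  by move: sub; rewrite !inE => /and3P[_ _]; apply: leq_ltn_trans.
apply: leq_trans (subset_leq_card sub) _.
apply: leq_trans (_ : \sum_(v < n.+1 | Q v) k <= _).
  elim/big_rec2: _ => [|v m B /andP[/emb[_ cv _ _ _] _] le_m]; first by rewrite cards0.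
  by rewrite -cv (leq_trans (leq_card_setU _ _)) // leq_add2l.
rewrite sum_nat_const mulnC leq_mul2l -sum1_card; apply/orP; right.
rewrite exchange_big /= big_mkcond; apply: leq_sum => v _.
rewrite unfold_in; case: ifP => // /andP[/andP[pv ltK] lt_b].
have lt_p : parent (part v) < (parent c).+1.
  by have := part_le_n v; move: ltK; rewrite -keyc /key; nia.
by rewrite (bigD1 (Ordinal lt_p)) //= pv eqxx.
Qed.

(** Used vertices take at most half of the guaranteed size of the available region; the rest has
    density at least $1/(2D)$, as [dense_block] requires. *)
Lemma free_block K f b c : partial_embedding K f b ->
  0 < c -> c <= n -> key c = K -> 0 < weight c ->
  exists (S : {set U}) b1, [/\ A * weight c <= #|S|,
    S \subset segment s (b1 - 4 * D * (A * weight c)) b1,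
    b1 <= frontier (parent c),
    forall v, placed K v -> [disjoint f v & S]
  & 0 < parent c -> complete_to (f (attach c)) S].
Proof.
move=> emb c0 le_cn keyc w0.
have [b0 [N0 [h1 h2 h3 h4]]] := available_region emb c0 le_cn keyc.
have lt_pc := attach_lt c0; rewrite -/(parent c) in lt_pc.
pose Y := \bigcup_(v < n.+1 | placed K v) f v.
have A0 : 0 < A by lia.
have le_w := weight_offspring c0.
have le_size : frontier (parent c) <= size s by apply: frontier_size; lia.
have used : 2 * D * #|N0 :&: Y| <= frontier (parent c) - b0.
  have u1 : #|N0 :&: Y| <= #|segment s b0 (size s) :&: Y|.
    apply: subset_leq_card; apply: setSI; apply: subset_trans h2 _.
    exact: segmentS.
  have u2 := card_used b0 emb c0 le_cn keyc; have u3 := used_bound h1.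
  rewrite -/Y in u2; move: u1 u2 u3; rewrite /slack.
  move: #|N0 :&: Y| => x; move: #|_ :&: Y| => y.
  move: (\sum_(j < _ | _) _) (_ - b0) => z d xy yz zd; have le_x : x <= 2 * A * z.
    by apply: leq_trans xy (leq_trans yz _); rewrite leq_mul2r le_kA orbT.
  by have := leq_mul (leqnn (4 * D)) le_x; lia.
have [|||||b1 le_b1 le_a] :=
  @dense_block _ s (N0 :\: Y) b0 (frontier (parent c)) (A * weight c) D.
- exact: subset_trans (subsetDl _ _) h2.
- by rewrite muln_gt0 A0.
- by [].
- have := leq_mul (leqnn (8 * D * A)) le_w; move: h1; rewrite /slack.
  have -> : 8 * D * A * weight c = 2 * (4 * D * (A * weight c)) by lia.
  by move: (4 * D * _) (8 * D * A * _) => x y; lia.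
- by have := cardsID Y N0; move: used h3; nia.
exists ((N0 :\: Y) :&: segment s (b1 - 4 * D * (A * weight c)) b1), b1; split=> //.
- exact: subsetIr.
- move=> v pl; rewrite disjoint_sym disjoints_subset; apply/subsetP => x.
  rewrite !inE => /andP[/andP[xY _] _]; apply: contra xY => xv.
  by apply/bigcupP; exists (Ordinal (placed_lt pl)).
- by move=> p0 x y xf; rewrite !inE => /andP[/andP[_ yN] _]; apply: h4.
Qed.

Lemma embed_part K f b c : partial_embedding K f b ->
  0 < c -> c <= n -> key c = K -> 0 < weight c ->
  exists f' b', partial_embedding K.+1 f' b'.
Proof.
move=> emb c0 le_cn keyc w0.
have [S [b1 [S1 S2 S3 S4 S5]]] := free_block emb c0 le_cn keyc w0.
have fr := frontier_parent c0.
have le_size : frontier c <= size s by exact: frontier_size.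
(* [slack] is twice $4DA$, so [W] is at least twice as long as the block of [S], and the gap up to
   [b1] is at most half of [W]. *)
have sl : 2 * (4 * D * (A * weight c)) = slack * weight c by rewrite /slack; lia.
have le_b1 : b1 + slack * (weight c + offspring c) <= frontier c by lia.
have sl0 : 0 < slack * weight c by rewrite /slack !muln_gt0 D_gt0 w0 /=; lia.
pose W := segment s b1 (frontier c).
have cW : #|W| = frontier c - b1 by rewrite card_segment.
have [|||x xS|g [g1 g2 g3]] := @place_part c S W c0 w0.
- by apply/subsetP => x /(subsetP S2); rewrite inE -sZ => /andP[].
- by [].
- by rewrite cW; move: le_b1; rewrite mulnDr; lia.
- have := subsetP S2 _ xS; rewrite !inE => /and3P[xs h1 h2].
  have := segment_outdegree uniq_s s_median xs h2 (_ : b1 <= frontier c) le_size.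
  by rewrite -/W cW; move: le_b1; rewrite mulnDr; lia.
have [e1 e2 e3 e4] := emb.
have old v : placed K v -> (part v == c) = false.
  by case/andP => _ lt; apply/eqP => E0; move: lt; rewrite E0 keyc ltnn.
have cases v : placed K.+1 v -> part v = c \/ placed K v.
  rewrite /placed ltnS [_ <= K]leq_eqVlt => /andP[pv].
  case/orP=> [/eqP E0|->]; last by rewrite pv; right.
  left; move: E0; rewrite -keyc /key => E0; have := part_le_n v => le_v.
  (* Reducing the key modulo [n.+1] recovers the part. *)
  by have := congr1 (modn^~ n.+1) E0; rewrite !modnMDl !modn_small.
exists (fun v => if part v == c then g v else f v), (fun i => if i == c then b1 else b i).
have le_b1c : b1 <= frontier c by lia.
split.
- move=> v /cases[pv|pl].
    rewrite pv eqxx; have [a1 a2 a3 a4] := g1 _ pv; split => //.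
    + by apply: subset_trans a1 (subset_trans S2 (segmentS _ _ _)).
    + by move: le_b1; rewrite mulnDr; lia.
    + by rewrite -cW.
  by rewrite (old _ pl); apply: e1.
- move=> u v /cases[pu|plu] /cases[pv|plv] uv.
  + by rewrite pu pv eqxx; apply: g2.
  + rewrite pu eqxx (old _ plv) disjoint_sym; have [a1 _ _ _] := g1 _ pu.
    by apply: disjointWr a1 (S4 _ plv).
  + rewrite pv eqxx (old _ plu); have [a1 _ _ _] := g1 _ pv.
    by apply: disjointWr a1 (S4 _ plu).
  + by rewrite (old _ plu) (old _ plv); apply: e2.
- move=> u v /cases[pu|plu] puv Euv.
    by rewrite -puv pu eqxx; apply: g3 => //; rewrite -puv.
  by rewrite -puv (old _ plu); apply: e3.
- move=> v /cases[pv|plv] p0.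
    have -> : (part (attach (part v)) == c) = false.
      by rewrite pv; have := attach_lt c0; lia.
    rewrite pv eqxx; have [/subsetP a1 _ _ _] := g1 _ pv.
    by move=> x y xf /a1; apply: S5 => //; rewrite -pv.
  (* A child of [c] has key above $c(n+1)$, beyond that of [c], so none is placed yet. *)
  have -> : (part (attach (part v)) == c) = false.
    have := plv; rewrite /placed -keyc /key => /andP[pv lt].
    have := attach_lt pv; rewrite -/(parent (part v)) => lt'.
    apply/negP => /eqP E0; have := part_le_n v; have := attach_lt c0.
    by rewrite -/(parent _) in E0 *; nia.
  by rewrite (old _ plv); apply: e4.
Qed.

Lemma partial_embedding_exists K : exists f b, partial_embedding K f b.
Proof.
elim: K => [|K [f [b emb]]].
  by exists (fun=> set0), (fun=> 0); split=> [v|u v|u v|v]; rewrite /placed ltn0 andbF.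
(* Only [K %% n.+1] can be the part with key [K]; if it is not, or is empty, nothing changes. *)
have [/and3P[c0 /eqP keyc w0]|no_part] := boolP [&& 0 < K %% n.+1,
    key (K %% n.+1) == K & 0 < weight (K %% n.+1)].
  by apply: (embed_part emb c0 _ keyc w0); rewrite -ltnS ltn_mod.
exists f, b; suff same v : placed K.+1 v = placed K v.
  by have [e1 e2 e3 e4] := emb; split=> [v|u v|u v|v]; rewrite !same; eauto.
rewrite /placed ltnS [_ <= K]leq_eqVlt; case: eqP => //= E0; case: posnP => //= pv.
case/negP: no_part; have le_v := part_le_n v.
have -> : K %% n.+1 = part v by rewrite -E0 /key modnMDl modn_small.
rewrite pv E0 eqxx /=.
have lt_v : v < n.+1 by rewrite ltnS leqNgt; apply/negP => /part_out p0; rewrite p0 in pv.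
by rewrite /weight (bigD1 (Ordinal lt_v)) //= pv eqxx.
Qed.
End PartialEmbedding.

Lemma embedding_exists : 24 * D * A * covered <= #|Z| ->
  exists f : nat -> {set U},
  [/\ forall v, 0 < part v -> [/\ f v \subset Z, #|f v| = k & R (f v)],
      forall u v, 0 < part u -> 0 < part v -> u != v -> [disjoint f u & f v],
      forall u v, 0 < part u -> part u = part v -> E u v ->
        complete_to (f u) (f v)
    & forall v, 0 < part v -> 0 < part (attach (part v)) ->
        complete_to (f (attach (part v))) (f v)].
Proof.
move=> Z_large; have [s [uniq_s sZ s_median]] := median_order_exists T_semicomplete Z.
have [f [b [e1 e2 e3 e4]]] :=
  (* All keys lie below $(n+1)^2$. *)
  partial_embedding_exists uniq_s sZ s_median Z_large (n.+1 * n.+1).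
have pl v : 0 < part v -> placed (n.+1 * n.+1) v.
  move=> pv; rewrite /placed pv /key.
  have := attach_lt pv; rewrite -/(parent _); have := part_le_n v; nia.
exists f; split=> [v /pl/e1[sub cf rf _ _]|u v /pl pu /pl|u v /pl|v /pl];
  [split=> // | exact: e2 | exact: e3 | exact: e4].
by apply/subsetP => x /(subsetP sub); rewrite inE -sZ => /andP[].
Qed.

End Embedding.

(** * Blow-ups of numbered trees *)

Section NumberedTree.
(* [bw v] says that the arc between [v] and its parent points to the parent;
   [par v = 0] when [v] has no parent. *)
Variables (n : nat) (par : nat -> nat) (bw : pred nat).
Hypothesis par_lt : forall v, 0 < v -> par v < v.
Hypothesis bw_par : forall v, bw v -> 0 < par v < v.

Let step v := if bw v then par v else v.
(** Each step that moves decreases the number, so [v] iterations reach the root of the piece. *)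
Definition top v := iter v step v.

Lemma iter_step_top m v : v <= m -> iter m step v = top v.
Proof.
elim/ltn_ind: v m => v IH m le_vm; rewrite /top.
case bv: (bw v); last first.
  have fixv j : iter j step v = v by elim: j => //= j ->; rewrite /step bv.
  by rewrite !fixv.
have /andP[_ lt_v] := bw_par bv.
case: v m => // v [//|m] in IH le_vm bv lt_v *.
by rewrite !iterSr {2 4}/step bv !IH //; lia.
Qed.

Lemma top_bw v : bw v -> top v = top (par v).
Proof.
move=> bv; have /andP[_ lt_v] := bw_par bv.
rewrite -(iter_step_top (leqnSn v)) iterSr {2}/step bv.
by apply: iter_step_top; lia.
Qed.

Lemma top_id v : ~~ bw v -> top v = v.
Proof.
by move=> /negbTE bv; rewrite /top; elim: {1}v => //= j ->; rewrite /step bv.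
Qed.

Lemma top_bounds v : (top v <= v) && ((0 < v) ==> (0 < top v)).
Proof.
elim/ltn_ind: v => v IH; case bv: (bw v); last by rewrite top_id ?bv // leqnn implybb.
have /andP[p0 lt_v] := bw_par bv; rewrite top_bw //.
by have /andP[h1] := IH _ lt_v; rewrite p0 /= => ->; rewrite implybT (leq_trans h1) // ltnW.
Qed.

Lemma top_le v : top v <= v. Proof. by case/andP: (top_bounds v). Qed.
Lemma top_gt0 v : 0 < v -> 0 < top v.
Proof. by move=> v0; have /andP[_ /implyP->] := top_bounds v. Qed.

(** A piece is named by its root, its least vertex; [0] again marks the vertices outside the
    domain. *)
Definition piece v := if v <= n then top v else 0.

Lemma piece_le v : piece v <= v.
Proof. by rewrite /piece; case: ifP => // _; apply: top_le. Qed.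

Section Blowup.
Variables (U : finType) (T : rel U) (k : nat).
Hypothesis T_semicomplete : forall x y, x != y -> T x y || T y x.
Hypothesis k_gt0 : 0 < k.
Let D := 32 ^ k.
Let D_gt0 : 0 < D. Proof. by rewrite expn_gt0. Qed.

Let T' : rel U := fun x y => T y x.

(** Kovari-Sos-Turan is applied to pairs in $W \times W'$: a quarter on each side gives a sixteenth
    of the pairs. The two common neighbourhoods have densities at most 1 with product at least
    $1/D$, so each density is at least $1/D$. *)
Lemma common_out_pair (S W W' : {set U}) : 0 < #|W| -> 0 < #|W'| ->
  (forall x, x \in S -> #|W| <= 4 * #|[set y in W | T x y]|) ->
  (forall x, x \in S -> #|W'| <= 4 * #|[set y in W' | T' x y]|) ->
  32 * k <= #|S| ->
  exists X : {set U}, [/\ X \subset S, #|X| = k,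
    #|W| <= D * #|common_out T W X| & #|W'| <= D * #|common_out T' W' X|].
Proof.
move=> W0 W0' deg deg' leS.
pose r x (y : U * U) := T x y.1 && T' x y.2.
have [|X [sX cX le_X]] := @kovari_sos_turan U _ r k S (setX W W') k_gt0 leS.
  move=> x xS; have -> : [set y in setX W W' | r x y]
      = setX [set y in W | T x y] [set y in W' | T' x y].
    by apply/setP => -[y z]; rewrite !inE /r /= andbACA.
  by rewrite !cardsX; have := leq_mul (deg x xS) (deg' x xS); lia.
exists X; split=> //; move: le_X.
all: have -> : [set y in setX W W' | [forall i in X, r i y]]
      = setX (common_out T W X) (common_out T' W' X).
1,3: apply/setP => -[y z]; rewrite !inE /= andbACA; congr (_ && _).
1,2: apply/forall_inP/andP => [h|[/forall_inP h1 /forall_inP h2] x xX];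
  [split; apply/forall_inP => x /h /andP[] | rewrite /r /= h1 ?h2] => //.
all: rewrite !cardsX -/D.
- have : #|common_out T' W' X| <= #|W'|.
    by apply: subset_leq_card; apply/subsetP => y; rewrite inE => /andP[].
  move: W0'; move: #|W| #|W'| #|common_out T W X| #|common_out T' _ _| => a b c d b0 db h.
  by rewrite -(leq_pmul2r b0) (leq_trans h) // mulnA leq_mul2l db orbT.
- have : #|common_out T W X| <= #|W|.
    by apply: subset_leq_card; apply/subsetP => y; rewrite inE => /andP[].
  move: W0; move: #|W| #|W'| #|common_out T W X| #|common_out T' _ _| => a b c d b0 db h.
  by rewrite -(leq_pmul2l b0) (leq_trans h) // mulnCA leq_mul2r db orbT.
Qed.

(** The embedding result is used for [T'] inside [S] with single vertices as parts: parents are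
    placed first, while the arcs of a piece point to its root. The condition [R] carries the large
    common out-neighbourhood in [W] that child pieces need. *)
Lemma embed_piece (c : nat) (S W : {set U}) :
  0 < c -> 24 * D * (32 * k) * weight n piece c <= #|S| -> 0 < #|W| ->
  (forall x, x \in S -> #|W| <= 4 * #|[set y in W | T x y]|) ->
  exists g : nat -> {set U},
   [/\ forall v, piece v = c ->
         [/\ g v \subset S, #|g v| = k & #|W| <= D * #|common_out T W (g v)|],
       forall u v, piece u = c -> piece v = c -> u != v ->
         [disjoint g u & g v]
     & forall u v, piece u = c -> piece v = c -> bw u && (par u == v) ->
         complete_to T (g u) (g v)].
Proof.
move=> c0 leS W0 deg.
pose part' v := if piece v == c then v else 0.
pose attach' v := if bw v then par v else 0.
have part'_le v : part' v <= v by rewrite /part'; case: ifP.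
have part'_out v : n < v -> part' v = 0.
  by move=> lt; rewrite /part' /piece leqNgt lt /=; case: eqP c0 => // <-.
have attach'_lt v : 0 < v -> part' (attach' v) < v.
  move=> v0; apply: leq_ltn_trans (part'_le _) _; rewrite /attach'.
  by case: ifP => // _; apply: par_lt.
have T'_sc x y : x != y -> T' x y || T' y x by move/T_semicomplete; rewrite orbC.
have covered' : covered n part' = weight n piece c.
  apply: eq_bigr => v _; rewrite /part' c0 /=; case: eqP => // pv.
  by have := piece_le v; rewrite pv; case: (v : nat) => // ; lia.
have le_k : k <= 2 * (32 * k) by lia.
have [||g [g1 g2 _ g4]] :=
  @embedding_exists U T' T'_sc k (32 * k) D n part' attach'
  (fun _ _ => false) (fun X => #|W| <= D * #|common_out T W X|) S
  k_gt0 D_gt0 le_k part'_le part'_out attach'_lt _ _.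
- move=> c' S' W' c0' w0' sS' leS' W0' deg'.
  have [||X [sX cX cW cW']] := @common_out_pair S' W W' W0 W0' _ deg'.
  + by move=> x /(subsetP sS'); apply: deg.
  + by apply: leq_trans leS'; rewrite leq_pmulr.
  (* A part is a single vertex here, so disjointness is vacuous. *)
  exists (fun=> X); split=> // u v; rewrite /part'.
  case: ifP => [_ ->|_ E0]; last by rewrite -E0 in c0'.
  by case: ifP => [_ ->|_ E0]; [rewrite eqxx | rewrite -E0 in c0'].
- by rewrite covered'.
have pos v : piece v = c -> 0 < part' v.
  by move=> pv; rewrite /part' pv eqxx; have := piece_le v; lia.
exists g; split=> [v /pos/g1[]|u v /pos pu /pos|u v pu pv /andP[bu /eqP puv]] //;
  first exact: g2.
move=> x y xu yv; have := g4 u (pos _ pu).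
have -> : part' u = u by rewrite /part' pu eqxx.
rewrite /attach' bu puv => /(_ (pos _ pv)); apply => //.
Qed.

Lemma blow_up_numbered_tree : 24 * D * (24 * D * (32 * k)) * n <= #|U| ->
  exists f : nat -> {set U},
  [/\ forall v, 0 < v <= n -> #|f v| = k,
      forall u v, 0 < u <= n -> 0 < v <= n -> u != v -> [disjoint f u & f v],
      forall v, 0 < v <= n -> bw v -> complete_to T (f v) (f (par v))
    & forall v, 0 < v <= n -> ~~ bw v -> 0 < par v ->
        complete_to T (f (par v)) (f v)].
Proof.
move=> leU.
have piece_out v : n < v -> piece v = 0 by rewrite /piece ltnNge => /negbTE->.
have attach_lt c : 0 < c -> piece (par c) < c.
  by move=> c0; apply: leq_ltn_trans (piece_le _) (par_lt c0).
have pos v : 0 < v <= n -> 0 < piece v.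
  by case/andP => v0 vn; rewrite /piece vn top_gt0.
have le_kA : k <= 2 * (24 * D * (32 * k)) by have := D_gt0; nia.
have [||f [f1 f2 f3 f4]] :=
  @embedding_exists U T T_semicomplete k (24 * D * (32 * k)) D n
  piece par (fun u v => bw u && (par u == v)) (fun=> True) setT
  k_gt0 D_gt0 le_kA piece_le piece_out attach_lt _ _.
- move=> c S W c0 _ _ leS W0 deg.
  have [g [g1 g2 g3]] := embed_piece c0 leS W0 deg.
  by exists g; split=> // v /g1[].
- rewrite cardsT; apply: leq_trans leU; rewrite leq_mul2l; apply/orP; right.
  (* Number [0] lies in the virtual part, so at most [n] vertices are covered. *)
  rewrite /covered big_ord_recl (_ : piece _ = 0) ?add0n; last first.
    by apply/eqP; rewrite -leqn0 piece_le.
  by rewrite -[n in _ <= n]card_ord -sum1_card leq_sum // => v _; case: (0 < _).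
exists f; split=> [v /pos/f1[]|u v /pos pu /pos|v vn bv|v vn bv p0] //; first exact: f2.
- apply: f3; [exact: pos | | by rewrite bv eqxx].
  have /andP[_ lt_p] := bw_par bv; have /andP[_ le_n] := vn.
  by rewrite /piece le_n (leq_trans (ltnW lt_p)) // top_bw.
(* A vertex outside [bw] is the root of its piece, so that piece is attached at the parent of the
   vertex itself. *)
- have vE : piece v = v by rewrite /piece; case/andP: vn => _ ->; apply: top_id.
  have := f4 v (pos v vn); rewrite vE; apply; apply: pos; rewrite p0 /=.
  by have := par_lt (_ : 0 < v); case/andP: vn => v0 vn /(_ v0); lia.
Qed.
End Blowup.
End NumberedTree.

(** * Numbering the vertices of a tree *)

Section TreeOrder.
Variables (V : finType) (g : rel V).
Hypothesis g_sym : symmetric g.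
Hypothesis g_conn : forall x y, connect g x y.
Hypothesis g_acyclic : forall c : seq V, 2 < size c -> ~ ucycle g c.

Definition earlier_nbrs (s : seq V) (x : V) := [seq y <- take (index x s) s | g x y].

(** The connecting paths are simple and stay in [s], so that a new vertex with two earlier
    neighbours would close one of them to a cycle. *)
Definition tree_ordered (s : seq V) : Prop :=
  [/\ uniq s,
      forall x y, x \in s -> y \in s ->
        exists p, [/\ path g x p, last x p = y, {subset p <= s} & uniq (x :: p)]
    & forall x, x \in s -> size (earlier_nbrs s x) <= 1].

Lemma tree_ordered_rcons (s : seq V) (x v : V) : tree_ordered s ->
  x \in s -> v \notin s -> g x v -> tree_ordered (rcons s v).
Proof.
move=> [us conn nbrs] xs vs gxv; split; first by rewrite rcons_uniq vs us.
- have to_v y : y \in s -> exists p,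
      [/\ path g y p, last y p = v, {subset p <= rcons s v} & uniq (y :: p)].
    move=> ys; have [p [pp lp sp up]] := conn _ _ ys xs.
    exists (rcons p v); split; rewrite ?last_rcons //.
    + by rewrite rcons_path pp lp.
    + by move=> z; rewrite !mem_rcons !inE => /orP[->//|/sp->]; rewrite orbT.
    + rewrite -rcons_cons rcons_uniq up andbT inE negb_or.
      rewrite (contraNneq _ vs) => [|->//]; apply: contra vs; exact: sp.
  have from_v y : y \in s -> exists p,
      [/\ path g v p, last v p = y, {subset p <= rcons s v} & uniq (v :: p)].
    move=> ys; have [p [pp lp sp up]] := conn _ _ xs ys.
    have sp' z : z \in x :: p -> z \in s by rewrite inE => /predU1P[->//|/sp].
    exists (x :: p); split => //.
    + by rewrite /= g_sym gxv.
    + by move=> z /sp'; rewrite mem_rcons inE => ->; rewrite orbT.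
    + by rewrite cons_uniq up andbT; apply: contra vs; apply: sp'.
  move=> y z; rewrite !mem_rcons !inE => /predU1P[->|ys] /predU1P[->|zs].
  + by exists [::].
  + exact: from_v.
  + exact: to_v.
  + have [p [pp lp sp up]] := conn _ _ ys zs; exists p; split=> //.
    by move=> t /sp; rewrite mem_rcons inE => ->; rewrite orbT.
- move=> y; rewrite /earlier_nbrs -cats1 mem_cat index_cat inE.
  have [ys _|_ /= /eqP->] := boolP (y \in s).
    by rewrite takel_cat ?index_size //; apply: nbrs.
  rewrite eqxx addn0 take_size_cat //.
  case fE: [seq z <- s | g v z] => [|a [|b t]] //.
  have := filter_uniq (g v) us; rewrite fE /= inE negb_or => /andP[/andP[ab _] _].
  have : a \in [seq z <- s | g v z] by rewrite fE mem_head.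
  rewrite mem_filter => /andP[gva a_s].
  have : b \in [seq z <- s | g v z] by rewrite fE inE mem_head orbT.
  rewrite mem_filter => /andP[gvb b_s].
  have [p [pp lp sp up]] := conn _ _ a_s b_s.
  have [] := @g_acyclic (v :: a :: p).
    by case: p lp {pp sp up} => //= abE; rewrite abE eqxx in ab.
  rewrite /ucycle cons_uniq up andbT inE negb_or /= rcons_path gva pp lp g_sym gvb /=.
  by apply/andP; split; [apply: contraNneq vs => -> | apply: contra vs; apply: sp].
Qed.

Lemma tree_ordered_exists m : 0 < m <= #|V| ->
  exists2 s, tree_ordered s & size s = m.
Proof.
case: m => // m /=; elim: m => [/card_gt0P[x _]|m IH lt_m].
  exists [:: x] => //; split=> // [y z|y].
    rewrite !inE => /eqP-> /eqP->; exists [::]; by split.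
  rewrite /earlier_nbrs /=; case: eqP => // _ /=.
  by case: ifP.
have [s ts size_s] := IH (ltnW lt_m).
have [us _ _] := ts.
have [v vs] : exists v, v \notin s.
  apply/existsP; rewrite -negb_forall; apply/negP => /forallP all_s.
  move: lt_m; rewrite -size_s -(card_uniqP us) ltnNge => /negP[].
  by apply: subset_leq_card; apply/subsetP.
have [x xs] : exists x, x \in s by case: (s) size_s => // x s' _; exists x; rewrite mem_head.
have [[y z] /= /and3P[ys zs gyz]] :
    exists yz : V * V, [&& yz.1 \in s, yz.2 \notin s & g yz.1 yz.2].
  (* A path from inside [s] to [v] must leave [s] along some edge. *)
  apply/existsP; apply: contraT => /existsPn closed_s.
  have /connectP[p pp vE] := g_conn x v.
  suff: v \in s by rewrite (negbTE vs).
  rewrite vE; elim: p x xs pp {vE} => //= y p IHp x xs /andP[gxy]; apply: IHp.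
  by have := closed_s (x, y); rewrite /= xs gxy andbT /= negbK.
by exists (rcons s z); [apply: (tree_ordered_rcons ts ys zs gyz) | rewrite size_rcons size_s].
Qed.

End TreeOrder.

Lemma oriented_tree_numbering (V : finType) (F : rel V) : oriented_tree F ->
  exists (id : V -> nat) (par : nat -> nat) (bw : pred nat),
  [/\ injective id, forall v, 0 < id v <= #|V|,
      forall c, 0 < c -> par c < c, forall c, bw c -> 0 < par c < c
    & forall u v, F u v -> bw (id u) /\ par (id u) = id v
                        \/ ~~ bw (id v) /\ par (id v) = id u].
Proof.
move=> [g [[g_sym g_irr] V0 g_conn g_acyclic] gF].
have le_V : 0 < #|V| <= #|V| by rewrite V0 leqnn.
have [s [us _ nbrs] size_s] := tree_ordered_exists g_sym g_conn g_acyclic le_V.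
have all_s v : v \in s.
  have /subset_cardP/(_ (subset_predT _)) -> // : #|s| = #|V|.
  by rewrite (card_uniqP us).
have [x0 _] := card_gt0P V0.
(* Numbers start at 1, so that [0] can stand for a missing parent. *)
pose num v := (index v s).+1.
pose nb c := earlier_nbrs g s (nth x0 s c.-1).
pose par c := if nb c is y :: _ then if 0 < c then num y else 0 else 0.
pose bw c := if nb c is y :: _ then (0 < c) && F (nth x0 s c.-1) y else false.
have nbE v : nb (num v) = earlier_nbrs g s v by rewrite /nb /= nth_index.
have par_lt c : 0 < c -> par c < c.
  case: c => // c _; rewrite /par; case nbc: (nb _) => [|y t] //=.
  have : y \in nb c.+1 by rewrite nbc mem_head.
  rewrite /nb mem_filter => /andP[_]; rewrite in_take // ltnS => lt_y.
  apply: (leq_trans lt_y) => /=; have [lt_c|le_c] := ltnP c (size s).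
    by rewrite index_uniq.
  (* Numbers beyond the tree read the default [x0], whose index is at most [size s]. *)
  by apply: leq_trans le_c; rewrite index_size.
have step u v : g u v -> index u s < index v s ->
    par (num v) = num u /\ bw (num v) = F v u.
  move=> guv lt_uv; rewrite /par /bw nbE.
  have uin : u \in earlier_nbrs g s v by rewrite mem_filter g_sym guv in_take.
  have := nbrs v (all_s v); case nbv: (earlier_nbrs g s v) uin => [|y [|z t]] //=.
  by rewrite inE => /eqP -> _; rewrite nth_index.
exists num, par, bw; split=> //.
- by move=> u v [/(congr1 (nth x0 s))]; rewrite !nth_index.
- by move=> v; rewrite /num /= -size_s index_mem.
- move=> c bc; have c0 : 0 < c by move: bc; rewrite /bw; case: (nb c) => // ? ? /andP[].
  by rewrite par_lt // andbT; move: bc; rewrite /par /bw c0; case: (nb c).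
- move=> u v Fuv; have [_ guv] := gF u v; have {}guv := guv Fuv.
  have [xorF _] := gF u v; have := xorF guv; rewrite Fuv /= => nFvu.
  have [lt|lt|eq] := ltngtP (index u s) (index v s).
  + by right; have [-> ->] := step _ _ guv lt.
  + by rewrite g_sym in guv; left; have [-> ->] := step _ _ guv lt.
  + by move: guv; rewrite -(nth_index x0 (all_s u)) eq nth_index // g_irr.
Qed.

(** * Subdigraphs from injective homomorphisms, and the conclusion *)

Lemma contains_embedding (U V : finType) (t : rel U) (d : rel V) (f : V -> U) :
  injective f -> (forall x y, d x y -> t (f x) (f y)) -> contains t d.
Proof.
move=> injf homf; pose S := f @: [set: V].
have fS v : f v \in S by apply: imset_f.
pose a (x y : {x : U | x \in S}) :=
  [exists u, [exists v, [&& f u == val x, f v == val y & d u v]]].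
exists S, a; split=> [x y /existsP[u /existsP[v /and3P[/eqP<- /eqP<- /homf]]]|] //.
pose h v : {x : U | x \in S} := exist _ (f v) (fS v).
have injh : injective h by move=> u v [/injf].
exists h.
  apply: (inj_card_bij injh).
  by rewrite card_sig /= (eq_card (B := S)) ?card_imset ?cardsT.
move=> x y; apply/existsP/idP => [[u /existsP[v /and3P[/eqP/injf-> /eqP/injf->]]]|dxy] //.
by exists x; apply/existsP; exists y; rewrite !eqxx.
Qed.

Theorem theorem18 (V : finType) (F : rel V) (n k : nat) (hF : oriented_tree F)
  (hn : #|V| = n) (hk : 0 < k) (U : finType) (T : rel U) (hT : tournament T)
  (hU : 2 ^ (10 + 18 * k) * k * n <= #|U|) :
  contains T (blow_up F k).
Proof.
have [id [par [bw [id_inj id_le par_lt bw_par arcs]]]] := oriented_tree_numbering hF.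
have T_sc x y : x != y -> T x y || T y x.
  by move=> /(proj1 (hT x y)); case: (T x y); case: (T y x).
have [|f [card_f disj_f arc_bw arc_fw]] := blow_up_numbered_tree par_lt bw_par T_sc hk (n := n).
  apply: leq_trans hU; rewrite leq_mul2r; apply/orP; right.
  (* Here $24 \cdot 24 \cdot 32 \le 32^3$, and $5(2k+3) \le 10+18k$ because $k \ge 1$. *)
  apply: (@leq_trans (32 ^ (k + k + 3) * k)).
    rewrite !expnD [32 ^ 3]expnS [32 ^ 2]expnS expn1.
    by move: (32 ^ k) => e; nia.
  by rewrite leq_mul2r -(expnM 2 5) leq_exp2l //; apply/orP; right; lia.
rewrite hn in id_le.
have [x0 _] : exists x0 : U, x0 \in U.
  have [g [_ V0 _ _] _] := hF; apply/card_gt0P; apply: leq_trans hU.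
  by rewrite -mulnA muln_gt0 expn_gt0 /= muln_gt0 hk -hn V0.
(* Copy [i] of a tree vertex goes to entry [i] of the set that replaces it; this set has size [k],
   so the default [x0] is never reached. *)
pose phi (p : V * 'I_k) := nth x0 (enum (f (id p.1))) p.2.
have size_f v : size (enum (f (id v))) = k by rewrite -cardE card_f.
have phi_in p : phi p \in f (id p.1) by rewrite -mem_enum mem_nth // size_f.
apply: (contains_embedding (f := phi)) => [[u i] [v j] eq_phi|[u i] [v j] /arcs]; last first.
  move=> [[bu parE]|[bv parE]] /=.
    by apply: (arc_bw _ (id_le u) bu _ _ (phi_in (u, i))); rewrite parE; apply: (phi_in (v, j)).
  apply: (arc_fw _ (id_le v) bv); [|rewrite parE; exact: (phi_in (u, i))|exact: (phi_in (v, j))].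
  by rewrite parE; case/andP: (id_le u).
have [uv|neq_uv] := eqVneq (id u) (id v).
  have {}uv := id_inj _ _ uv; rewrite -uv in eq_phi *; congr (_, _); apply/val_inj.
  by apply/eqP; move/eqP: eq_phi; rewrite /phi /= nth_uniq ?size_f ?enum_uniq.
have /pred0P /(_ (phi (u, i))) := disj_f _ _ (id_le u) (id_le v) neq_uv.
by rewrite /= (phi_in (u, i)) eq_phi (phi_in (v, j)).
Qed.
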